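(* Assume $\mathsf{CH}$. Then Miller Lite forcing $\mathbb{ML}$ preserves the dense maximality of every selective independent family: if $\mathcal I$ is a selective independent family, then $\Vdash_{\mathbb{ML}}$ ''$\mathcal I$ is densely maximal''.
   Context: Miller Lite forcing $\mathbb{ML}$ consists of finitely branching trees $T\subseteq\omega^{<\omega}$ such that for every $s\in T$ and every $n<\omega$ there is $t\in T$ with $t\supseteq s$ having at least $n$ immediate successors in $T$; the order is inclusion. For $\mathcal I\subseteq[\omega]^\omega$, $\mathrm{FF}(\mathcal I)$ is the set of finite partial functions from $\mathcal I$ to $\{0,1\}$ and $\mathcal I^g=\bigcap\{A:g(A)=1\}\cap\bigcap\{\omega\setminus A:g(A)=0\}$; $\mathcal I$ is independent if all $\mathcal I^g$ are infinite. An independent $\mathcal I$ is densely maximal if for every $X\in[\omega]^\omega$ and $g'\in\mathrm{FF}(\mathcal I)$ there is $g\supseteq g'$ in $\mathrm{FF}(\mathcal I)$ with $\mathcal I^g\cap X$ or $\mathcal I^g\setminus X$ finite. The density filter $\mathrm{fil}(\mathcal I)$ is the set of $X\subseteq\omega$ such that for every $g'\in\mathrm{FF}(\mathcal I)$ there is $g\supseteq g'$ with $\mathcal I^g\setminus X$ finite. A family is Ramsey if it is a P-set (countable subfamilies have pseudointersections in it) and a Q-set (every partition of $\omega$ into finite pieces has a semiselector in it). $\mathcal I$ is selective if it is densely maximal and $\mathrm{fil}(\mathcal I)$ is Ramsey. *)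

(* Defs.v *)
From mathcomp Require Import all_boot.
From mathcomp Require Import mathcomp_extra boolp classical_sets functions.
From mathcomp Require Import cardinality.

Set Implicit Arguments.
Unset Strict Implicit.
Unset Printing Implicit Defensive.

Local Open Scope classical_set_scope.
Local Open Scope card_scope.

Definition CH : Prop :=
  forall A : set (set nat), countable A \/ A #= [set: set nat].

(** * Independent families

    A partial function from a family to {0,1} is given by its graph, with
    [true] for 1 and [false] for 0. *)

Definition FF (I : set (set nat)) : set (set (set nat * bool)) :=
  [set g | [/\ finite_set g,
               forall A b, g (A, b) -> I A
             & forall A b c, g (A, b) -> g (A, c) -> b = c]].

(** [Ig g] is I^g.  Intersections are taken inside omega, so that the empty
    function gives omega. *)
Definition Ig (g : set (set nat * bool)) : set nat :=
  (\bigcap_(A in [set A | g (A, true)]) A) `&`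
  (\bigcap_(A in [set A | g (A, false)]) ~` A).

Definition independent (I : set (set nat)) : Prop :=
  (forall A, I A -> infinite_set A) /\
  (forall g, FF I g -> infinite_set (Ig g)).

Definition densely_maximal (I : set (set nat)) : Prop :=
  independent I /\
  forall X : set nat, infinite_set X -> forall g', FF I g' ->
    exists g, [/\ FF I g, g' `<=` g &
      finite_set (Ig g `&` X) \/ finite_set (Ig g `\` X)].

Definition density_filter (I : set (set nat)) : set (set nat) :=
  [set X | forall g', FF I g' ->
     exists g, [/\ FF I g, g' `<=` g & finite_set (Ig g `\` X)]].

Definition pseudointersection (H : set (set nat)) (B : set nat) : Prop :=
  infinite_set B /\ forall A, H A -> finite_set (B `\` A).

Definition P_set (F : set (set nat)) : Prop :=
  forall H, H `<=` F -> countable H -> exists2 B, F B & pseudointersection H B.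

Definition semiselector (E : set (set nat)) (B : set nat) : Prop :=
  forall e, E e -> is_subset1 (B `&` e).

Definition Q_set (F : set (set nat)) : Prop :=
  forall E : set (set nat), partition E id [set: nat] ->
    (forall e, E e -> finite_set e) -> exists2 B, F B & semiselector E B.

Definition Ramsey (F : set (set nat)) : Prop := P_set F /\ Q_set F.

Definition selective (I : set (set nat)) : Prop :=
  densely_maximal I /\ Ramsey (density_filter I).

(** * Miller Lite forcing *)

Definition succs (T : set (seq nat)) (t : seq nat) : set nat :=
  [set k | T (rcons t k)].

(** Conditions are nonempty: the empty set satisfies the other clauses
    vacuously, and would lie below every condition. *)
Definition miller_lite (T : set (seq nat)) : Prop :=
  [/\ T !=set0,
      forall s t, prefix s t -> T t -> T s,
      forall s, T s -> finite_set (succs T s)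
    & forall s n, T s -> exists t, [/\ T t, prefix s t & `I_n #<= succs T t]].

Definition ML : Type := {T : set (seq nat) | miller_lite T}.

Definition ML_le (S T : ML) : Prop := sval S `<=` sval T.

(** * Forcing

    A P-name is a set of pairs (name, condition), here an indexed family of
    such pairs, as in Aczel's encoding of sets as well-founded trees. *)

Inductive name (P : Type) : Type :=
  Name (A : Type) (elt : A -> name P) (cond : A -> P).

(** Formulas of the forcing language: first-order formulas in [Mem] and [Eq]
    with names as parameters.  A quantified formula is given by its instances
    at all names. *)
Inductive formula (P : Type) : Type :=
| Mem (x y : name P)
| Eq (x y : name P)
| Neg (F : formula P)
| And (F G : formula P)
| Or (F G : formula P)
| Imp (F G : formula P)
| FAll (F : name P -> formula P)
| FEx (F : name P -> formula P).

Declare Scope forcing_scope.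
Delimit Scope forcing_scope with frc.
Bind Scope forcing_scope with formula.

Notation "x '\In' y" := (Mem x y) (at level 70) : forcing_scope.
Notation "x = y" := (Eq x y) : forcing_scope.
Notation "~ F" := (Neg F) : forcing_scope.
Notation "F /\ G" := (And F G) : forcing_scope.
Notation "F \/ G" := (Or F G) : forcing_scope.
Notation "F -> G" := (Imp F G) : forcing_scope.
Notation "'All' x , F" := (FAll (fun x => F%frc))
  (at level 200, x name, F at level 200) : forcing_scope.
Notation "'Ex' x , F" := (FEx (fun x => F%frc))
  (at level 200, x name, F at level 200) : forcing_scope.
Notation "'All' x '\In' a , F" := (FAll (fun x => Imp (Mem x a) F%frc))
  (at level 200, x name, a at level 69, F at level 200) : forcing_scope.
Notation "'Ex' x '\In' a , F" := (FEx (fun x => And (Mem x a) F%frc))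
  (at level 200, x name, a at level 69, F at level 200) : forcing_scope.

Section Forcing.
Variables (P : Type) (le : P -> P -> Prop).

Definition dense_below (p : P) (D : P -> Prop) : Prop :=
  forall q, le q p -> exists2 r, le r q & D r.

(** The atomic clause for equality is extensionality, each inclusion being
    "p forces f a \In y for all a whose condition is in the generic filter". *)
Fixpoint forces_eq (x y : name P) {struct x} : P -> Prop :=
  match x, y with
  | @Name _ A f c, @Name _ B g d => fun p =>
      (forall a q, le q p -> le q (c a) -> dense_below q (fun r =>
         exists2 b, le r (d b) & forces_eq (f a) (g b) r)) /\
      (forall b q, le q p -> le q (d b) -> dense_below q (fun r =>
         exists2 a, le r (c a) & forces_eq (f a) (g b) r))
  end.

Definition forces_mem (x y : name P) (p : P) : Prop :=
  match y with
  | @Name _ B g d =>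
      dense_below p (fun q => exists2 b, le q (d b) & forces_eq x (g b) q)
  end.

Fixpoint forces (p : P) (F : formula P) {struct F} : Prop :=
  match F with
  | Mem x y => forces_mem x y p
  | Eq x y => forces_eq x y p
  | Neg F => forall q, le q p -> ~ forces q F
  | And F G => forces p F /\ forces p G
  | Or F G => dense_below p (fun q => forces q F \/ forces q G)
  | Imp F G => forall q, le q p -> forces q F -> forces q G
  | FAll F => forall x, forces p (F x)
  | FEx F => dense_below p (fun q => exists x, forces q (F x))
  end.

Definition forced (F : formula P) : Prop := forall p, forces p F.

End Forcing.

(** * Canonical names of ground model sets

    There need not be a largest condition, so a canonical name carries each of
    its elements with every condition. *)

Section CanonicalNames.
Variable P : Type.

Definition ground_name (A : Type) (f : A -> name P) : name P :=
  Name (fun i : A * P => f i.1) (fun i => i.2).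

Definition succ_name (x : name P) : name P :=
  match x with
  | @Name _ A f c =>
      Name (fun i : A + P => match i with inl a => f a | inr _ => x end)
           (fun i => match i with inl a => c a | inr p => p end)
  end.

(** von Neumann numerals *)
Fixpoint nat_name (n : nat) : name P :=
  match n with
  | 0 => ground_name (fun v : void => match v with end)
  | m.+1 => succ_name (nat_name m)
  end.

Definition omega_name : name P := ground_name nat_name.

Definition set_name (A : set nat) : name P :=
  ground_name (fun k : {k | A k} => nat_name (sval k)).

Definition family_name (I : set (set nat)) : name P :=
  ground_name (fun A : {A | I A} => set_name (sval A)).

End CanonicalNames.

Arguments nat_name {P} n.
Arguments omega_name {P}.
Arguments set_name {P} A.
Arguments family_name {P} I.

(** * Dense maximality as a formula of set theory *)

Section Formulas.
Variable P : Type.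
Local Open Scope forcing_scope.
Implicit Types (x y z a b h g k n X I : name P) (F G : formula P).

Definition Iff F G : formula P := (F -> G) /\ (G -> F).

Definition Subset x y : formula P := All z \In x, z \In y.

Definition IsUpair z x y : formula P := All w, Iff (w \In z) (w = x \/ w = y).

Definition IsOpair z x y : formula P :=
  Ex u, Ex v, (IsUpair u x x /\ IsUpair v x y /\ IsUpair z u v).

Definition OpairIn x y h : formula P := Ex z \In h, IsOpair z x y.

Definition IsRel h a b : formula P :=
  All z \In h, Ex x \In a, Ex y \In b, IsOpair z x y.

Definition ExUniqueIn a (F : name P -> formula P) : formula P :=
  Ex x \In a, (F x /\ All x' \In a, (F x' -> x' = x)).

Definition IsBij h a b : formula P :=
  IsRel h a b /\
  (All x \In a, ExUniqueIn b (fun y => OpairIn x y h)) /\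
  (All y \In b, ExUniqueIn a (fun x => OpairIn x y h)).

Definition Fin x : formula P := Ex n \In omega_name, Ex h, IsBij h n x.

Definition FinClass (F : name P -> formula P) : formula P :=
  Ex y, ((All k, Iff (k \In y) (F k)) /\ Fin y).

Definition InfSubsetOmega X : formula P := Subset X omega_name /\ ~ Fin X.

Definition InFF I g : formula P :=
  Fin g /\ IsRel g I (nat_name 2) /\
  (All A, All i, All j, (OpairIn A i g -> OpairIn A j g -> i = j)).

Definition InIg g k : formula P :=
  k \In omega_name /\
  (All A, (OpairIn A (nat_name 1) g -> k \In A)) /\
  (All A, (OpairIn A (nat_name 0) g -> ~ k \In A)).

Definition Independent I : formula P :=
  (All A \In I, InfSubsetOmega A) /\
  (All g, (InFF I g -> ~ FinClass (InIg g))).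

Definition DenselyMaximal I : formula P :=
  Independent I /\
  All X, (InfSubsetOmega X -> All g', (InFF I g' ->
    Ex g, (InFF I g /\ Subset g' g /\
      (FinClass (fun k => InIg g k /\ k \In X) \/
       FinClass (fun k => InIg g k /\ ~ k \In X))))).

End Formulas.

(* Main.v *)
Require Import Defs.
From mathcomp Require Import all_boot.
From mathcomp Require Import mathcomp_extra boolp classical_sets functions.
From mathcomp Require Import cardinality.

(** Fix a condition p, a name X for a subset of omega and g0 in FF(I), and let
    Y_q be the set of n that some r <= q forces into X.  If some Y_q with q <= p
    meets some I^h, h extending g0, in a finite set, then q forces I^h and X to
    be almost disjoint.  Otherwise dense maximality puts every Y_q, enlarged by
    the complement of I^g0, into the density filter.  Conditions are finitely
    branching, so at each step of a fusion only finitely many nodes have to be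
    kept, and a number n in the finite intersection of the corresponding Y_q can
    be forced into X without removing any of them.  As the density filter is
    Ramsey, the numbers can be chosen so that they form a set B in it, and the
    fusion then forces X to contain almost all of B on I^g0, hence almost all
    of some I^h. *)

Set Implicit Arguments.
Unset Strict Implicit.
Unset Printing Implicit Defensive.

Local Open Scope classical_set_scope.
Local Open Scope card_scope.

(** * Fusion for Miller Lite forcing *)

Lemma ML_le_refl (T : ML) : ML_le T T.
Proof. by []. Qed.

Lemma ML_le_trans (S T U : ML) : ML_le S T -> ML_le T U -> ML_le S U.
Proof. by move=> ST TU t /ST /TU. Qed.

(** Thresholds of finitely many points can be replaced by their maximum, which serves all of them at
    once. *)
Lemma finite_bound (T : Type) (A : set T) (P : T -> nat -> Prop) :
  finite_set A -> (forall x, A x -> exists n, forall m, n <= m -> P x m) ->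
  exists n, forall x m, A x -> n <= m -> P x m.
Proof.
move=> finA H; have /choice[f fP] x : exists n, A x -> forall m, n <= m ->
  P x m.
  have [Ax|nAx] := pselect (A x); last by exists 0.
  by have [n] := H x Ax; exists n.
(* The thresholds are listed rather than the points, since [T] need not have decidable equality. *)
have /finite_seqP[s sE] : finite_set (f @` A) by exact: finite_image.
exists (\max_(i <- s) i) => x m Ax le_m; apply: fP => //; apply: leq_trans le_m.
have: [set` s] (f x) by rewrite -sE; exists x.
by move=> /= fs; rewrite (big_rem _ fs) /= leq_maxl.
Qed.

Section Trees.
Implicit Types (S T : ML) (s t : seq nat) (l n k : nat).

Lemma ML_prefix T s t : prefix s t -> sval T t -> sval T s.
Proof. by move: (svalP T) => [_ h _ _]; apply: h. Qed.

Lemma ML_root T : sval T [::].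
Proof.
by have [[t Tt] _ _ _] := svalP T; apply: ML_prefix Tt; rewrite prefix0s.
Qed.

(** Some node above [s] has a successor; either it is [s] itself, or the path to it starts with a
    successor of [s]. *)
Lemma ML_succ T s : sval T s -> exists k, sval T (rcons s k).
Proof.
move=> Ts; have [_ _ _ /(_ s 1 Ts)[t [Tt st ht]]] := svalP T.
have [k Tk] : succs (sval T) t !=set0.
  apply: contrapT => /set0P/negP/negPn/eqP e.
  by move: ht; rewrite e =>
    /card_le_trans/(_ (subset_card_le (@sub0set _ `I_0)));
     rewrite card_le_II.
case/prefixP: st Tt Tk => u -> Tt Tk.
case: u Tt Tk => [|x u] Tt Tk; first by exists k; rewrite cats0 in Tk.
exists x; apply: ML_prefix Tt; apply/prefixP; exists u.
by rewrite cat_rcons.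
Qed.

Lemma ML_extend T s l : sval T s -> size s <= l ->
  exists t, [/\ sval T t, prefix s t & size t = l].
Proof.
move=> Ts /subnKC <-; elim: (l - size s) => [|n [t [Tt st sz]]].
  by exists s; rewrite addn0 prefix_refl.
have [k Tk] := ML_succ Tt; exists (rcons t k); split => //.
  by apply: prefix_trans st _; rewrite prefix_rcons.
by rewrite size_rcons sz addnS.
Qed.

(** Finite branching, by induction on [l]. This is what leaves only finitely many nodes to handle at
    each stage of the fusion. *)
Lemma finite_level T l : finite_set [set t | sval T t /\ size t = l].
Proof.
elim: l => [|l IH].
  apply: (@sub_finite_set _ _ [set [::]]); last exact: finite_set1.
  by move=> t [_ /size0nil].
apply: (@sub_finite_set _ _ (\bigcup_(t in [set t | sval T t /\ size t = l])
   (rcons t @` succs (sval T) t))).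
  move=> t [Tt]; case/lastP: t Tt => // t k Tt; rewrite size_rcons => -[sz].
  exists t; last by exists k.
  by split => //; apply: ML_prefix Tt; rewrite prefix_rcons.
apply: bigcup_finite => // t [Tt _]; apply: finite_image.
by have [_ _ h _] := svalP T; apply: h.
Qed.

Lemma prefix_comparable (s t u : seq nat) : prefix s u -> prefix t u ->
  prefix s t \/ prefix t s.
Proof.
rewrite !prefixE => /eqP su /eqP tu.
have [le|/ltnW le] := leqP (size s) (size t); [left|right].
  by rewrite -tu take_takel // su.
by rewrite -su take_takel // tu.
Qed.

Lemma prefix_size_eq (s t : seq nat) : prefix s t -> size s = size t -> s = t.
Proof. by rewrite prefixE => /eqP st e; rewrite -st e take_size. Qed.

Lemma ML_at_miller_lite T t : sval T t ->
  miller_lite [set s | sval T s /\ (prefix s t \/ prefix t s)].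
Proof.
have [_ _ fT bT] := svalP T.
move=> Tt; split.
- by exists t; split => //; left; rewrite prefix_refl.
- move=> s u su [Tu cu]; split; first exact: ML_prefix Tu.
  case: cu => [ut|tu]; first by left; exact: prefix_trans ut.
  exact: prefix_comparable su tu.
- move=> s [Ts _]; apply: sub_finite_set (fT s Ts).
  by move=> k [].
- move=> s n [Ts c].
  have [s' [Ts' ss' ts']] : exists s', [/\ sval T s',
    prefix s s' & prefix t s'].
    case: c => h; [exists t|exists s]; by split => //; rewrite prefix_refl.
  have [u [Tu s'u nu]] := bT s' n Ts'.
  have tu := prefix_trans ts' s'u.
  exists u; split; [|exact: prefix_trans ss' s'u|].
    by split => //; right.
  apply: card_le_trans nu (subset_card_le _) => k Tk; split => //.
  by right; apply: prefix_trans tu _; rewrite prefix_rcons.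
Qed.

(** The default [T] off the tree spares a membership proof as argument, and [ML_at_le] holds for
    every [t]. *)
Definition ML_at T t : ML :=
  match pselect (sval T t) with
  | left h => exist _ _ (ML_at_miller_lite h)
  | right _ => T
  end.

Lemma ML_atE T t : sval T t ->
  sval (ML_at T t) = [set s | sval T s /\ (prefix s t \/ prefix t s)].
Proof. by rewrite /ML_at; case: pselect. Qed.

Lemma ML_at_le T t : ML_le (ML_at T t) T.
Proof. by rewrite /ML_at; case: pselect => [h s []|_ s]. Qed.

(** [S] has a node of length [size t], and [t] is the only sequence of that length comparable with
    [t]. *)
Lemma le_ML_at_mem S T t : sval T t -> ML_le S (ML_at T t) -> sval S t.
Proof.
move=> Tt le; have [u [Su _ sz]] := ML_extend (ML_root S) (leq0n (size t)).
have := le u Su; rewrite ML_atE // => -[_ [h|h]].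
  by rewrite -(prefix_size_eq h sz).
by rewrite (prefix_size_eq h (esym sz)).
Qed.

Definition fusion_le l S T :=
  ML_le S T /\ forall s, sval T s -> size s <= l -> sval S s.

(** * Gluing conditions along a level of a tree *)

Section Amalgamation.
Variables (T : ML) (l : nat) (r : seq nat -> ML).
Hypothesis rT : forall t, sval T t -> size t = l -> ML_le (r t) (ML_at T t).

Let amalgam_set : set (seq nat) :=
  [set s | exists t, [/\ sval T t, size t = l & sval (r t) s]].

(** Finite branching is inherited from [T], and splitting from the one [r t] that contains the given
    node. *)
Let amalgam_miller_lite : miller_lite amalgam_set.
Proof.
have [_ _ fT bT] := svalP T.
split.
- have [t [Tt _ sz]] := ML_extend (ML_root T) (leq0n l).
  by exists [::]; exists t; split => //; exact: ML_root.
- move=> s u su [t [Tt sz ru]]; exists t; split => //; exact: ML_prefix ru.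
- move=> s [t [Tt sz rs]]; apply: sub_finite_set (fT s _).
    by move=> k [t' [Tt' sz' /(rT Tt' sz') /ML_at_le]].
  exact: ML_at_le (rT Tt sz rs).
- move=> s n [t [Tt sz rs]]; have [_ _ _ br] := svalP (r t).
  have [u [ru su nu]] := br s n rs; exists u; split => //.
    by exists t.
  by apply: card_le_trans nu (subset_card_le _) => k rk; exists t.
Qed.

Definition amalgam : ML := exist _ _ amalgam_miller_lite.

Lemma amalgam_fusion : fusion_le l amalgam T.
Proof.
split => [s [t [Tt sz rs]]|s Ts sz]; first exact: ML_at_le (rT Tt sz rs).
have [t [Tt st szt]] := ML_extend Ts sz.
exists t; split => //; apply: ML_prefix st _.
exact: le_ML_at_mem (rT Tt szt).
Qed.

(** At a node [t] of level [l] the amalgam coincides with [r t]. Hence whatever all the [r t] force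
    is forced densely below the amalgam. *)
Lemma amalgam_dense q : ML_le q amalgam ->
  exists t, [/\ sval T t, size t = l, sval q t & ML_le (ML_at q t) (r t)].
Proof.
move=> le; have [t [qt _ sz]] := ML_extend (ML_root q) (leq0n l).
have rE t' : sval T t' -> size t' = l -> sval (r t') t -> t' = t.
  move=> Tt' sz' /(rT Tt' sz'); rewrite ML_atE // => -[_ [h|h]].
    by rewrite (prefix_size_eq h) // sz sz'.
  by rewrite (prefix_size_eq h) // sz sz'.
have [t' [Tt' sz' rt']] := le t qt.
have E := rE t' Tt' sz' rt'; subst t'.
exists t; split => // s; rewrite ML_atE // => -[qs c].
case: c => [st|ts]; first exact: ML_prefix st rt'.
have [u [Tu su ru]] := le s qs.
by rewrite -(rE u Tu su) //; apply: ML_prefix ts ru.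
Qed.

End Amalgamation.

(** The strict bound on [size t] puts also the successors of [t] at height at most [l'], so that
    freezing up to [l'] preserves the splitting. *)
Definition splits_between n l l' T :=
  forall s, sval T s -> size s = l ->
    exists t, [/\ sval T t, prefix s t,
      size t < l' & `I_n #<= succs (sval T) t].

Lemma exists_splits_between n l T :
  exists l', l < l' /\ splits_between n l l' T.
Proof.
have [_ _ _ bT] := svalP T.
have [|l' hl'] := @finite_bound _ [set s | sval T s /\ size s = l]
  (fun s m => exists t, [/\ sval T t, prefix s t, size t < m &
     `I_n #<= succs (sval T) t]) (finite_level T l).
  move=> s [Ts _]; have [t [Tt st nt]] := bT s n Ts.
  exists (size t).+1 => m lem; exists t; split => //.
exists (maxn l' l.+1); split; first by rewrite leq_maxr.
by move=> s Ts sz; apply: hl' => //; rewrite leq_maxl.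
Qed.

(** * Limits of fusion sequences *)

Section Fusion.
Variables (T : nat -> ML) (l : nat -> nat).
Hypothesis lS : forall n, l n < l n.+1.
Hypothesis TS : forall n, fusion_le (l n) (T n.+1) (T n).
Hypothesis Tsplit : forall n, splits_between n (l n) (l n.+1) (T n.+1).

Let T_le m n : n <= m -> ML_le (T m) (T n).
Proof.
move=> /subnKC <-; elim: (m - n) => [|k IH]; first by rewrite addn0.
by rewrite addnS; apply: ML_le_trans IH; have [] := TS (n + k).
Qed.

Let l_le m n : n <= m -> l n <= l m.
Proof.
move=> /subnKC <-; elim: (m - n) => [|k IH]; first by rewrite addn0.
by rewrite addnS; apply: leq_trans IH (ltnW _).
Qed.

Let l_ge n : n <= l n.
Proof. by elim: n => // n IH; apply: leq_ltn_trans IH (lS n). Qed.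

Let T_agree m n s : sval (T n) s -> size s <= l n -> sval (T m) s.
Proof.
move=> Ts sz; have [le|/ltnW le] := leqP m n; first exact: (T_le le).
move: le => /subnKC <-; elim: (m - n) => [|k IH]; first by rewrite addn0.
rewrite addnS; have [_] := TS (n + k); apply => //.
by apply: leq_trans sz (l_le _); rewrite leq_addr.
Qed.

Let fusion_set : set (seq nat) := [set s | forall n, sval (T n) s].

Let fusion_miller_lite : miller_lite fusion_set.
Proof.
have [_ _ fT _] := svalP (T 0).
split.
- by exists [::] => n; exact: ML_root.
- by move=> s t st Tt n; apply: ML_prefix st (Tt n).
- by move=> s Ts; apply: sub_finite_set (fT s (Ts 0)) => k /(_ 0).
(* A stage late enough both for [n]-splitting and for [s] to lie at height at most [l m]. *)
- move=> s n Ts; pose m := maxn n (size s).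
  have [u [Tu su szu]] : exists t, [/\ sval (T m) t, prefix s t & size t = l m].
    by apply: ML_extend => //; apply: leq_trans (l_ge m); rewrite leq_maxr.
  have [_ /(_ u Tu)] := TS m; rewrite szu leqnn => /(_ isT) Tu'.
  have [t [Tt ut szt nt]] := Tsplit Tu' szu.
  (* [t] and its successors have length at most [l m.+1], so they survive all later stages. *)
  exists t; split; first by move=> k; apply: T_agree Tt (ltnW szt).
    exact: prefix_trans su ut.
  have nm : `I_n #<= `I_m by rewrite card_le_II leq_maxl.
  apply: card_le_trans nm (card_le_trans nt (subset_card_le _)) => i Ti k.
  by apply: T_agree Ti _; rewrite size_rcons.
Qed.

Lemma ML_fusion : exists q, forall n, ML_le q (T n).
Proof. by exists (exist _ _ fusion_miller_lite) => n s /=. Qed.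

End Fusion.
End Trees.

(** * The filter game *)

Lemma finite_nat_bounded (A : set nat) :
  finite_set A <-> exists n, forall x, A x -> x < n.
Proof.
split=> [finA|[n An]]; last exact: sub_finite_set (finite_II n).
have [|n nP] := @finite_bound _ A (fun x m => x < m) finA.
  by move=> x _; exists x.+1.
by exists n => x Ax; apply: nP.
Qed.

Lemma infinite_nat_unbounded (A : set nat) :
  infinite_set A -> forall n, exists2 x, A x & n <= x.
Proof.
move=> infA n; apply: contrapT => nex; apply: infA.
apply/finite_nat_bounded; exists n => x Ax; rewrite ltnNge; apply/negP => nx.
by apply: nex; exists x.
Qed.

Lemma least_above (A : set nat) : infinite_set A ->
  exists f : nat -> nat, forall n,
    [/\ A (f n), n <= f n & forall x, A x -> n <= x -> f n <= x].
Proof.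
move=> infA; have /choice[f fP] n : exists m,
    [/\ A m, n <= m & forall x, A x -> n <= x -> m <= x]; last by exists f.
have ex : exists m, `[< A m /\ n <= m >].
  by have [m Am nm] := infinite_nat_unbounded infA n; exists m; apply/asboolP.
exists (ex_minn ex); case: ex_minnP => m /asboolP[Am nm] mP.
by split => // x Ax nx; apply: mP; apply/asboolP.
Qed.

Section SelectiveFilter.
Variable F : set (set nat).
Hypothesis FI : forall A B, F A -> F B -> F (A `&` B).
Hypothesis ramF : Ramsey F.

Lemma Ramsey_infinite (A : set nat) : F A -> infinite_set A.
Proof.
move=> FA finA; have [P _] := ramF.
have [||B FB [infB BA]] := P [set A].
- by move=> _ ->.
- exact: countable1.
apply: infB; apply: (@sub_finite_set _ _ ((B `\` A) `|` A)).
  by move=> x Bx; have [Ax|nAx] := pselect (A x); [right|left].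
by rewrite finite_setU; split => //; apply: BA.
Qed.

(** The nonempty fibres of a finite-to-one map partition omega into finite pieces, and the map is
    injective on any semiselector of them. *)
Lemma Ramsey_inj (phi : nat -> nat) :
  (forall m, finite_set [set x | phi x = m]) ->
  exists2 B, F B & forall x y, B x -> B y -> phi x = phi y -> x = y.
Proof.
move=> finphi; have [_ Q] := ramF.
pose E := [set e | exists x, e = [set y | phi y = phi x]].
have [||B FB sB] := Q E.
- split.
  + apply/seteqP; split => // x _; exists [set y | phi y = phi x] => //.
    by exists x.
  + move=> _ _ [x ->] [y ->] [z [/= -> ->]] //.
  + by move=> _ [x ->]; exists x.
- by move=> _ [x ->].
exists B => // x y Bx By xy; apply: (sB [set z | phi z = phi y]) => //.
by exists y.
Qed.

Fixpoint history (b : nat -> nat) (n : nat) : seq nat :=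
  if n is m.+1 then b m :: history b m else [::].

(** The strictly decreasing lists with entries below [n]. As [history] puts the latest move first,
    they include all histories of increasing runs with moves below [n]. *)
Fixpoint decreasing_below (n : nat) : seq (seq nat) :=
  if n is m.+1 then decreasing_below m ++ map (cons m) (decreasing_below m)
  else [:: [::]].

Lemma decreasing_below_sub m n : m <= n ->
  {subset decreasing_below m <= decreasing_below n}.
Proof.
move=> /subnKC <-; elim: (n - m) => [|k IH] s; first by rewrite addn0.
by move=> /IH; rewrite addnS /= mem_cat => ->.
Qed.

(** Omega is cut into blocks from [N k] to [N k.+1] such that [f] maps everything up to [N k] to at
    most [N k.+1]. It suffices that distinct points of [C] lie in blocks that are neither equal nor
    adjacent. This follows from applying the Q-set property to both ways of pairing adjacent
    blocks. *)
Lemma spread_out (f : nat -> nat) :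
  exists2 C, F C & forall x y, C x -> C y -> x < y -> f x <= y.
Proof.
pose N := fix N k :=
  if k is j.+1 then (N j + \max_(i < (N j).+1) f i).+1 else 0.
have NS k : N k < N k.+1 by rewrite /= ltnS leq_addr.
have Nf k x : x <= N k -> f x <= N k.+1.
  rewrite -ltnS => xk /=; apply/leqW/(leq_trans _ (leq_addl _ _)).
  exact: (@leq_bigmax _ (fun i : 'I_(N k).+1 => f i) (Ordinal xk)).
have Nle j k : j <= k -> N j <= N k.
  move=> /subnKC <-; elim: (k - j) => [|i IH]; first by rewrite addn0.
  by rewrite addnS; apply: leq_trans IH (ltnW _).
have /choice[idx idxP] x : exists k, N k <= x < N k.+1.
  elim: x => [|x [k /andP[kx xk]]]; first by exists 0; apply/andP; split;
    last exact: (NS 0).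
  move: xk; rewrite leq_eqVlt => /orP[/eqP e|xk].
    by exists k.+1; rewrite e leqnn NS.
  by exists k; rewrite xk (leq_trans kx).
have idx_le x y : x <= y -> idx x <= idx y.
  move=> xy; rewrite leqNgt; apply/negP => /Nle yx.
  have /andP[ix _] := idxP x; have /andP[_ iy] := idxP y.
  by have := leq_trans iy (leq_trans yx (leq_trans ix xy)); rewrite ltnn.
(* If [h (idx x) = m], then [idx x] is at most [2m+1], so [x] lies below [N] at [2m+2]. *)
have idx_fin (h : nat -> nat) : (forall k, k <= (h k).*2.+1) ->
    forall m, finite_set [set x | h (idx x) = m].
  move=> hP m; apply/finite_nat_bounded; exists (N m.*2.+2) => x;
    rewrite /mkset => <-.
  have /andP[_ xi] := idxP x; apply: leq_trans xi (Nle _ _ _).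
  by rewrite ltnS.
(* Blocks [2j] and [2j+1] together contain at most one point of [C0]. *)
have [|C0 FC0 C0P] := @Ramsey_inj (fun x => (idx x)./2).
  apply: idx_fin => k; rewrite -{1}(odd_double_half k).
  by case: (odd k); rewrite ?leqnn ?leqnSn.
(* The shifted pairing: the same for blocks [2j-1] and [2j], and [C1]. *)
have [|C1 FC1 C1P] := @Ramsey_inj (fun x => (idx x).+1./2).
  apply: (idx_fin (fun k => k.+1./2)) => k.
  rewrite /= uphalf_half doubleD -{1}(odd_double_half k) -addnS.
  by rewrite leq_add ?leqnSn // -addnn leq_addr.
exists (C0 `&` C1); first exact: FI.
move=> x y [C0x C1x] [C0y C1y] xy.
(* Points in one block contradict the choice of [C0]; points in adjacent blocks contradict that of
   [C1] or [C0], according to the parity of the first block. *)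
have ixy : idx x < (idx y).-1.
  have := idx_le _ _ (ltnW xy); rewrite leq_eqVlt => /orP[/eqP e|].
    by move: xy; rewrite (C0P x y) ?ltnn // e.
  rewrite leq_eqVlt => /orP[/eqP e|]; last by case: (idx y).
  case: (boolP (odd (idx x))) => o.
    have e' : (idx x).+1./2 = (idx y).+1./2.
      by rewrite -e /= uphalf_half o.
    by move: xy; rewrite (C1P x y) ?ltnn.
  have e' : (idx x)./2 = (idx y)./2.
    by rewrite -e /= uphalf_half (negbTE o).
  by move: xy; rewrite (C0P x y) ?ltnn.
have /andP[_ /ltnW /Nf ix] := idxP x; have /andP[iy _] := idxP y.
apply: leq_trans ix (leq_trans (Nle _ _ _) iy).
by move: ixy; case: (idx y).
Qed.

(* [G] is a strategy for the player who, knowing the earlier moves, plays sets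
   in [F] from which the opponent picks numbers; it does not win. *)
Lemma filter_game (G : seq nat -> set nat) : (forall s, F (G s)) ->
  exists B b m, [/\ F B, forall n, G (history b n) (b n)
    & forall x, B x -> m <= x -> exists n, x = b n].
Proof.
move=> FG; have [P _] := ramF.
(* There are only countably many positions, so a single [B] in [F] is almost contained in every set
   the strategy can play. Below, [beta s] marks from where on [B] lies in [G s]. *)
have [||B FB [_ BG]] := P (range G).
- by move=> _ [s _ <-].
- exact: card_le_trans (card_image_le G setT) (countableP _).
have /choice[beta betaP] s : exists n, forall x, B x -> n <= x -> G s x.
  have [n nP] := (finite_nat_bounded _).1 (BG (G s) (ex_intro2 _ _ s I erefl)).
  exists n => x Bx nx; apply: contrapT => nG.
  by have := nP x (conj Bx nG); rewrite ltnNge nx.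
(* The maximum runs over all histories with moves at most [n]. In [C], the point after [n] is
   therefore beyond [beta] of every such history. *)
have [C FC CP] := spread_out (fun n =>
  \max_(s <- decreasing_below n.+1) beta s).
have FBC := FI FB FC; set D := B `&` C in FBC.
have [nxt nxtP] := least_above (Ramsey_infinite FBC).
(* The run enumerates [D] increasingly from [beta [::]] on, so that its range is almost all of
   [D]. *)
pose b := fix b n := if n is k.+1 then nxt (b k).+1 else nxt (beta [::]).
have bD n : D (b n) by case: n => [|n];
  [case: (nxtP (beta [::]))|case: (nxtP (b n).+1)].
have bS n : b n < b n.+1 by rewrite /=; case: (nxtP (b n).+1).
have bn n : n <= b n by elim: n => // n IH; apply: leq_ltn_trans IH (bS n).
exists D, b, (beta [::]); split => // [n|x Dx mx].
  have Bb : B (b n) by case: (bD n).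
  apply: betaP => //; case: n Bb => [|n] _ /=;
    first by case: (nxtP (beta [::])).
  have [_ Cn] := bD n; have [_ Cn'] := bD n.+1.
  apply: leq_trans (CP _ _ Cn Cn' (bS n)).
  have mem : (b n :: history b n) \in decreasing_below (b n).+1.
    have mem k : k <= n -> history b k \in decreasing_below (b k).
      elim: k => [_|k IH kn].
        exact: (@decreasing_below_sub 0).
      apply: (decreasing_below_sub (bS k)) => /=.
      by rewrite mem_cat map_f ?orbT // IH // ltnW.
    by rewrite /= mem_cat map_f ?orbT // mem.
  by rewrite (big_rem _ mem) /= leq_maxl.
(* The enumeration does not jump over [x]: it has met [x] already or has not passed it. At stage
   [x.+1] only the former is possible. *)
have alt n : b n <= x \/ exists k, x = b k.
  elim: n => [|n [|]]; last by right.
    by left; have [_ _] := nxtP (beta [::]); apply.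
  rewrite leq_eqVlt => /orP[/eqP <-|nx]; first by right; exists n.
  by left; have [_ _] := nxtP (b n).+1; apply.
have [h|//] := alt x.+1.
by have := leq_trans (bn x.+1) h; rewrite ltnn.
Qed.

End SelectiveFilter.

(** * Deciding a subset of omega on the density filter *)

Lemma Ig_sub (g h : set (set nat * bool)) : g `<=` h -> Ig h `<=` Ig g.
Proof. by move=> gh n [h1 h0]; split=> A /gh; [apply: h1|apply: h0]. Qed.

Section DensityFilter.
Variable I : set (set nat).

Lemma density_filterS (X Y : set nat) :
  X `<=` Y -> density_filter I X -> density_filter I Y.
Proof.
move=> XY FX g' /FX[g [Ig_ gg fin]]; exists g; split => //.
by apply: sub_finite_set fin => n [? nX]; split => // /XY.
Qed.

Lemma density_filterT : density_filter I setT.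
Proof. by move=> g Ig_; exists g; split => //; rewrite setDT. Qed.

(** The function found for [X] is extended once more for [Y]; extending only shrinks [Ig]. *)
Lemma density_filterI (X Y : set nat) :
  density_filter I X -> density_filter I Y -> density_filter I (X `&` Y).
Proof.
move=> FX FY g' /FX[g1 [/FY[g2 [I2 g12 fin2]] g1' fin1]].
exists g2; split => //; first exact: subset_trans g1' g12.
apply: (@sub_finite_set _ _ ((Ig g1 `\` X) `|` (Ig g2 `\` Y))).
  move=> n [/[dup] g2n /(Ig_sub g12) g1n nXY].
  have [Xn|nXn] := pselect (X n); last by left.
  by right; split => // Yn; apply: nXY.
by rewrite finite_setU.
Qed.

Lemma density_filter_bigcap (T : Type) (D : set T) (X : T -> set nat) :
  finite_set D -> (forall t, D t -> density_filter I (X t)) ->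
  density_filter I (\bigcap_(t in D) X t).
Proof.
(* The classical copy of [T] has the decidable equality needed to list [D]. *)
move=> finD FX; pose T' := {classic T}.
have [s sD] := (@finite_seqP T' D).1 finD.
have {FX} FX (t : T') : t \in s -> density_filter I (X t).
  by move=> ts; apply: FX; rewrite sD.
rewrite sD {sD finD D}; elim: s FX => [|t s IH] FX.
  by apply: density_filterS density_filterT => n _ t.
have FX' : density_filter I (\bigcap_(t in [set` s]) X t).
  by apply: IH => u us; apply: FX; rewrite in_cons us orbT.
have FXt : density_filter I (X t) by apply: FX; rewrite in_cons eqxx.
apply: density_filterS (density_filterI FXt FX') => n [Xn Xs] u /=.
by rewrite in_cons => /orP[/eqP -> //|]; apply: Xs.
Qed.

(** If [g'] contradicts [g0], then [Ig g'] lies in the complement of [Ig g0] and [g'] itself serves.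
    Otherwise dense maximality decides [Y] on an extension of the union of [g'] and [g0], and the
    hypothesis excludes a finite intersection with [Y]. *)
Lemma density_filter_relative (g0 : set (set nat * bool)) (Y : set nat) :
  densely_maximal I -> FF I g0 ->
  (forall h, FF I h -> g0 `<=` h -> infinite_set (Ig h `&` Y)) ->
  density_filter I (Y `|` ~` Ig g0).
Proof.
move=> [_ maxI] I0 infY g' I'.
have [[A [b [c [g'A g0A bc]]]]|compat] :=
    pselect (exists A b c, [/\ g' (A, b), g0 (A, c) & b <> c]).
  exists g'; split => //; rewrite (_ : _ `\` _ = set0) //.
  apply/seteqP; split => // n [[gt gf] nn]; apply: nn; right => -[ht hf].
  by case: b c bc g'A g0A => [] [] // _ g'A g0A;
    [apply: (hf A g0A); apply: gt|apply: (gf A g'A); apply: ht].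
have IU : FF I (g' `|` g0).
  case: I' I0 => [f' s' u'] [f0 s0 u0]; split.
  - by rewrite finite_setU.
  - by move=> A b [/s'|/s0].
  - move=> A b c [gb|gb] [gc|gc]; [exact: u' gb gc| | |exact: u0 gb gc];
      apply: contrapT => bc; apply: compat.
    + by exists A, b, c.
    + by exists A, c, b; split => // cb; apply: bc.
have infY0 : infinite_set Y.
  by move=> finY; apply: (infY g0 I0) => //; apply: sub_finite_set finY => n [].
have [g [Ig_ gU [fin|fin]]] := maxI Y infY0 _ IU.
  by case: (infY g Ig_ _ fin) => A ?; apply: gU; right.
exists g; split => //; first by move=> A ?; apply: gU; left.
by apply: sub_finite_set fin => n [gn nY]; split => // Yn; apply: nY; left.
Qed.

End DensityFilter.

(** * Fusion along a run of the filter game *)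

Section Preservation.
(* [E n q] stands for "q forces n into X". *)
Variable E : nat -> ML -> Prop.
Hypothesis E_le : forall n p q, ML_le q p -> E n p -> E n q.
Hypothesis E_dense : forall n p,
  (forall q, ML_le q p -> exists2 r, ML_le r q & E n r) -> E n p.

Let outer (q : ML) : set nat := [set n | exists2 r, ML_le r q & E n r].

(** The numbers that can still be forced into X above each node of level [l]; by [decide] they can
    be forced in without losing any of these nodes. *)
Let good (T : ML) (l : nat) : set nat :=
  \bigcap_(t in [set t | sval T t /\ size t = l]) outer (ML_at T t).

(** Above each node of level [l] a condition forcing [k] is chosen, and these are amalgamated. Every
    condition below the amalgam can be shrunk below one of them, so density applies. *)
Let decide T l k : good T l k -> exists2 S, fusion_le l S T & E k S.
Proof.
move=> gk.
have /choice[r rP] t : exists r, sval T t -> size t = l ->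
    ML_le r (ML_at T t) /\ E k r.
  have [Tt|nTt] := pselect (sval T t); last by exists T.
  have [sz|nsz] := pselect (size t = l); last by exists T.
  by have [r rT Er] := gk t (conj Tt sz); exists r.
have rT t Tt sz := proj1 (rP t Tt sz).
exists (amalgam rT); first exact: amalgam_fusion.
apply: E_dense => q /amalgam_dense[t [Tt sz qt qr]].
exists (ML_at q t); first exact: ML_at_le.
by apply: E_le qr _; have [] := rP t Tt sz.
Qed.

(** One fusion step in answer to the move [k]. It is defined for all [k], so that choice yields a
    function: for a bad [k] the tree is kept and only a new level is found. *)
Let next n (Tl : ML * nat) k : exists Sl : ML * nat,
  [/\ Tl.2 < Sl.2, fusion_le Tl.2 Sl.1 Tl.1,
      splits_between n Tl.2 Sl.2 Sl.1
    & good Tl.1 Tl.2 k -> E k Sl.1].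
Proof.
case: Tl => T l /=.
have [S ST ES] : exists2 S, fusion_le l S T & good T l k -> E k S.
  have [gk|ngk] := pselect (good T l k); last first.
    by exists T => //; split => //; apply: ML_le_refl.
  by have [S ST ES] := decide gk; exists S.
have [l' [ll' sp]] := exists_splits_between n l S.
by exists (S, l').
Qed.

Lemma decide_on_density_filter (I : set (set nat)) p
  (g0 : set (set nat * bool)) : selective I -> FF I g0 ->
  exists q h N, [/\ ML_le q p, FF I h, g0 `<=` h &
    (forall n r, N <= n -> Ig h n -> ML_le r q -> ~ E n r) \/
    (forall n, N <= n -> Ig h n -> E n q)].
Proof.
move=> [maxI ramI] I0; apply: contrapT => noq.
(* A finite intersection would give the first alternative, with [q], [h] and a bound for the
   intersection. *)
have inf_outer q h : ML_le q p -> FF I h -> g0 `<=` h ->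
    infinite_set (Ig h `&` outer q).
  move=> qp Ih gh /finite_nat_bounded[N hN]; apply: noq; exists q, h, N.
  split => //; left => n r Nn hn rq Er.
  by have := hN n (conj hn (ex_intro2 _ _ r rq Er)); rewrite ltnNge Nn.
have /choice[nxt nxtP] (a : nat * (ML * nat) * nat) := next a.1.1 a.1.2 a.2.
(* The stage of the fusion is a function of the history alone, as the strategy [G] requires. *)
pose state := fix state s := if s is k :: s'
  then nxt (size s', state s', k) else (p, 0).
have state_le s : ML_le (state s).1 p.
  elim: s => [|k s IH]; first exact: ML_le_refl.
  by apply: ML_le_trans IH; have [_ [le _] _ _] := nxtP (size s, state s, k).
(* The sets [outer] are large only relative to [Ig g0], whence the added complement. *)
pose G s := good (state s).1 (state s).2 `|` ~` Ig g0.
have FG s : density_filter I (G s).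
  apply: (density_filterS _ (@density_filter_bigcap I _
      [set t | sval (state s).1 t /\ size t = (state s).2]
      (fun t => outer (ML_at (state s).1 t) `|` ~` Ig g0) _ _)).
  - move=> n all; have [g0n|] := pselect (Ig g0 n); last by right.
    by left => t lt; have [] := all t lt.
  - exact: finite_level.
  - move=> t _; apply: density_filter_relative => // h Ih gh.
    by apply: inf_outer => //; apply: ML_le_trans (state_le s); apply: ML_at_le.
have [B [b [m [FB Gb Bb]]]] := filter_game (@density_filterI I) ramI FG.
pose st n := state (history b n).
(* The length of the history is the stage number, so stage [n] provides [n]-splitting. *)
have hist n : size (history b n) = n by elim: n => //= n ->.
have stS n := nxtP (n, st n, b n).
have stE n : st n.+1 = nxt (n, st n, b n) by rewrite /st /= hist.
have [q qT] : exists q, forall n, ML_le q (st n).1.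
  apply: (@ML_fusion (fun n => (st n).1) (fun n => (st n).2)) => n;
    by rewrite stE; case: (stS n).
(* [B] is in the density filter, so some [Ig h] with [h] extending [g0] is almost contained in
   [B]. *)
have [h [Ih gh /finite_nat_bounded[N hN]]] := FB g0 I0.
(* Beyond [N] the points of [Ig h] are in [B], and beyond [m] the points of [B] are moves of the
   run. *)
apply: noq; exists q, h, (maxn m N); split => //; first exact: (qT 0).
right => n; rewrite geq_max => /andP[mn Nn] hn.
have Bn : B n.
  apply: contrapT => nB; have := hN n (conj hn nB).
  by rewrite ltnNge Nn.
have [k kE] := Bb n Bn mn; subst n.
(* The point lies in [Ig h], hence in [Ig g0], so it was a good move and stage [k.+1] forces it into
   X. *)
have [gk|] := Gb k; last by case; apply: Ig_sub hn.
by apply: E_le (qT k.+1) _; rewrite stE; case: (stS k) => _ _ _; apply.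
Qed.

End Preservation.

(** * The forcing relation *)

Section ForcingTheorem.
Variables (P : Type) (le : P -> P -> Prop).
Hypothesis le_refl : forall p, le p p.
Hypothesis le_trans : forall p q r, le p q -> le q r -> le p r.
Implicit Types (p q r : P) (x y z : name P) (Q R : P -> Prop).

Local Notation D := (dense_below le).
Local Notation "p ||- F" := (forces le p F%frc) (at level 72).

Lemma dense_ret p Q : (forall q, le q p -> Q q) -> D p Q.
Proof. by move=> H q qp; exists q; [exact: le_refl|exact: H]. Qed.

(** Density below a condition behaves as a monad, with [dense_ret] as unit and this as bind; the
    arguments inside the forcing language are organised by it. *)
Lemma dense_bind p Q R :
  D p Q -> (forall q, le q p -> Q q -> D q R) -> D p R.
Proof.
move=> DQ H q qp; have [r rq Qr] := DQ q qp.
have [s sr Rs] := H r (le_trans rq qp) Qr r (le_refl r).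
by exists s => //; apply: le_trans sr rq.
Qed.

Lemma dense_le p q Q : le q p -> D p Q -> D q Q.
Proof. by move=> qp DQ r rq; apply: DQ; apply: le_trans rq qp. Qed.

Lemma dense_ex p Q : D p Q -> exists2 q, le q p & Q q.
Proof. by apply; exact: le_refl. Qed.

Lemma dense_map p Q R :
  D p Q -> (forall q, le q p -> Q q -> R q) -> D p R.
Proof.
move=> DQ H q qp; have [r rq Qr] := DQ q qp.
by exists r => //; apply: H => //; apply: le_trans rq qp.
Qed.

Lemma forces_eq_le x y p q : le q p -> forces_eq le x y p -> forces_eq le x y q.
Proof.
case: x y => A f c [B g d] qp [H1 H2].
by split=> a r rq; [apply: H1|apply: H2]; apply: le_trans rq qp.
Qed.

Lemma forces_eq_dense x y p : D p (forces_eq le x y) -> forces_eq le x y p.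
Proof.
case: x y => A f c [B g d] H; split=> a q qp qa s sq;
  have [r rs [H1 H2]] := H s (le_trans sq qp);
  have ra := le_trans rs (le_trans sq qa).
  have [t tr Ht] := H1 a r (le_refl r) ra r (le_refl r).
  by exists t => //; apply: le_trans tr rs.
have [t tr Ht] := H2 a r (le_refl r) ra r (le_refl r).
by exists t => //; apply: le_trans tr rs.
Qed.

Lemma forces_le F p q : le q p -> p ||- F -> q ||- F.
Proof.
elim: F p q => [x y|x y|F IF|F IF G IG|F IF G IG|F IF G IG|F IF|F IF] p q qp /=.
- by case: y => B g d; apply: dense_le.
- exact: forces_eq_le.
- by move=> H r rq; apply: H; apply: le_trans rq qp.
- by case=> /(IF _ _ qp) ? /(IG _ _ qp).
- exact: dense_le.
- by move=> H r rq; apply: H; apply: le_trans rq qp.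
- by move=> H x; apply: IF qp _.
- exact: dense_le.
Qed.

Lemma forces_mem_le x y p q :
  le q p -> forces_mem le x y p -> forces_mem le x y q.
Proof. exact: (@forces_le (x \In y)%frc). Qed.

(** By induction on the formula. Together with [forces_le] it allows passing to smaller conditions
    while proving that something is forced, usually through [forces_bind]. *)
Lemma forces_dense F p : D p (fun q => q ||- F) -> p ||- F.
Proof.
elim: F p => [x y|x y|F IF|F IF G IG|F IF G IG|F IF G IG|F IF|F IF] p /= H.
- by move: H; case: y => B g d /= H; apply: dense_bind H _.
- exact: forces_eq_dense.
- move=> q qp Fq; have [r rq Hr] := H q qp.
  by apply: Hr (le_refl r) _; apply: forces_le Fq.
- by split; [apply: IF|apply: IG]; apply: dense_map H _ => q _ [].
- by apply: dense_bind H _.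
- move=> q qp Fq; apply: IG; apply: dense_map (dense_le qp H) _ => r rq Hr.
  by apply: Hr (le_refl r) _; apply: forces_le Fq.
- by move=> x; apply: IF; apply: dense_map H _ => q _; apply.
- by apply: dense_bind H _.
Qed.

Lemma forces_bind F p Q :
  D p Q -> (forall q, le q p -> Q q -> q ||- F) -> p ||- F.
Proof. by move=> H QF; apply: forces_dense; apply: dense_map H _. Qed.

Lemma forces_ex (F : name P -> formula P) x p : p ||- F x -> p ||- FEx F.
Proof.
by move=> H; apply: dense_ret => q qp; exists x; apply: forces_le H.
Qed.

Lemma forces_and F G p : p ||- F -> p ||- G -> p ||- (F /\ G).
Proof. by []. Qed.

Lemma forces_orl F G p : p ||- F -> p ||- (F \/ G).
Proof. by move=> pF; apply: dense_ret => q qp; left; apply: forces_le pF. Qed.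

Lemma forces_orr F G p : p ||- G -> p ||- (F \/ G).
Proof. by move=> pG; apply: dense_ret => q qp; right; apply: forces_le pG. Qed.

Lemma forces_imp F G p :
  (forall q, le q p -> q ||- F -> q ||- G) -> p ||- (F -> G).
Proof. by []. Qed.

Lemma forces_all (F : name P -> formula P) p : (forall x, p ||- F x) ->
  p ||- FAll F.
Proof. by []. Qed.

Lemma forces_all_in (F : name P -> formula P) y p :
  (forall x q, le q p -> q ||- x \In y -> q ||- F x) ->
    p ||- (All x \In y, F x).
Proof. by move=> H x q qp; apply: H. Qed.

(** * Forced equality and substitution *)

Lemma eq_refl_forced x p : p ||- x = x.
Proof.
elim: x p => A f IH c p; split=> a q qp qa; apply: dense_ret => r rq;
  by exists a; [apply: le_trans rq qa|exact: (IH a r)].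
Qed.

Lemma eq_sym_forced x y p : p ||- x = y -> p ||- y = x.
Proof.
elim: x y p => A f IH c [B g d] p [H1 H2]; split=> a q qp qa.
  by apply: dense_map (H2 a q qp qa) _ => r _ [b rb /IH]; exists b.
by apply: dense_map (H1 a q qp qa) _ => r _ [b rb /IH]; exists b.
Qed.

Lemma eq_trans_forced x y z p : p ||- x = y -> p ||- y = z -> p ||- x = z.
Proof.
elim: x y z p => A f IH c [B g d] [C h e] p [H1 H2] [K1 K2]; split=> a q qp qa.
  apply: dense_bind (H1 a q qp qa) _ => r rq [b rb fg].
  apply: dense_map (K1 b r (le_trans rq qp) rb) _ => s sr [t st gh].
  by exists t => //; apply: IH gh; apply: forces_eq_le fg.
apply: dense_bind (K2 a q qp qa) _ => r rq [b rb gh].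
apply: dense_map (H2 b r (le_trans rq qp) rb) _ => s sr [t st fg].
by exists t => //; apply: IH fg _; apply: forces_eq_le gh.
Qed.

Lemma mem_eql x x' y p : p ||- x = x' -> p ||- x \In y -> p ||- x' \In y.
Proof.
case: y => B g d e H; apply: dense_map H _ => q qp [b qb xb].
exists b => //; apply: eq_trans_forced xb; apply: eq_sym_forced.
exact: forces_eq_le e.
Qed.

Lemma mem_eqr x y y' p : p ||- y = y' -> p ||- x \In y -> p ||- x \In y'.
Proof.
case: y y' => A f c [B g d] [H _] K.
apply: dense_bind K _ => q qp [a qa xa].
apply: dense_map (H a q qp qa) _ => r rq [b rb ab].
by exists b => //; apply: eq_trans_forced ab; apply: forces_eq_le xa.
Qed.

(** The clauses of [forces_eq] concern the listed elements of a name, and any condition below the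
    one attached to such an element forces it into the name. *)
Lemma eq_ext_forced x y p :
  (forall z q, le q p -> q ||- z \In x -> q ||- z \In y) ->
  (forall z q, le q p -> q ||- z \In y -> q ||- z \In x) -> p ||- x = y.
Proof.
case: x y => A f c [B g d] H K; split=> a q qp qa.
  apply: H => //; apply: dense_ret => r rq.
  by exists a; [apply: le_trans rq qa|apply: eq_refl_forced].
have : q ||- g a \In Name f c.
  apply: K => //; apply: dense_ret => r rq.
  by exists a; [apply: le_trans rq qa|apply: eq_refl_forced].
move=> H'; apply: dense_map H' _ => r _ [b rb e].
by exists b => //; apply: eq_sym_forced.
Qed.

(** A quantified formula is built from an arbitrary function on names, so substitution of equals is
    not automatic; it is derived connective by connective. *)
Definition respects (F : name P -> formula P) :=
  forall p x y, p ||- x = y -> p ||- F x -> p ||- F y.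

Definition name_respects (a : name P -> name P) :=
  forall p x y, p ||- x = y -> p ||- a x = a y.

Lemma name_respects_id : name_respects id.
Proof. by []. Qed.

Lemma name_respects_cst x : name_respects (fun=> x).
Proof. by move=> p *; apply: eq_refl_forced. Qed.

Lemma respects_mem a b : name_respects a -> name_respects b ->
  respects (fun x => a x \In b x)%frc.
Proof. by move=> ra rb p x y e /(mem_eql (ra _ _ _ e)) /(mem_eqr (rb _ _
  _ e)). Qed.

Lemma respects_eq a b : name_respects a -> name_respects b ->
  respects (fun x => a x = b x)%frc.
Proof.
move=> ra rb p x y e h; apply: eq_trans_forced (rb _ _ _ e).
by apply: eq_trans_forced h; apply: eq_sym_forced; apply: ra.
Qed.

Lemma respects_neg F : respects F -> respects (fun x => ~ F x)%frc.
Proof.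
move=> rF p x y e h q qp Fy; apply: (h q qp); apply: rF Fy.
by apply: eq_sym_forced; apply: forces_eq_le qp e.
Qed.

Lemma respects_and F G : respects F -> respects G ->
  respects (fun x => F x /\ G x)%frc.
Proof. by move=> rF rG p x y e [h k]; split; [apply: rF h|apply: rG k]. Qed.

Lemma respects_or F G : respects F -> respects G ->
  respects (fun x => F x \/ G x)%frc.
Proof.
move=> rF rG p x y e h; apply: dense_map h _ => q /forces_eq_le/(_ e) e'.
by case=> [h|h]; [left; apply: rF h|right; apply: rG h].
Qed.

Lemma respects_imp F G : respects F -> respects G ->
  respects (fun x => F x -> G x)%frc.
Proof.
move=> rF rG p x y e h q qp Fy; have e' := forces_eq_le qp e.
by apply: (rG _ _ _ e'); apply: h => //; apply: rF Fy; apply: eq_sym_forced.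
Qed.

Lemma respects_all (F : name P -> name P -> formula P) :
  (forall z, respects (F^~ z)) -> respects (fun x => FAll (F x)).
Proof. by move=> rF p x y e h z; apply: (rF z p x y e); apply: h. Qed.

Lemma respects_ex (F : name P -> name P -> formula P) :
  (forall z, respects (F^~ z)) -> respects (fun x => FEx (F x)).
Proof.
move=> rF p x y e h; apply: dense_map h _ => q qp [z Fz].
by exists z; apply: (rF z q x y _ Fz); apply: forces_eq_le e.
Qed.

Ltac solve_respects :=
  repeat first
    [ apply: name_respects_cst | apply: name_respects_id
    | apply: respects_mem | apply: respects_eq | apply: respects_neg
    | apply: respects_and | apply: respects_or | apply: respects_imp
    | apply: respects_all; intro | apply: respects_ex; intro ].

Lemma respects_IsOpair x y : respects (fun z => IsOpair z x y).
Proof. by rewrite /IsOpair /IsUpair /Iff; solve_respects. Qed.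

Lemma respects_InIg g : respects (InIg g).
Proof. by rewrite /InIg /OpairIn /IsOpair /IsUpair /Iff; solve_respects. Qed.

Lemma mem_ground A (f : A -> name P) x p :
  p ||- x \In ground_name f <-> D p (fun q => exists a, q ||- x = f a).
Proof.
split=> H; apply: dense_map H _ => q _; first by case=> [[a c] _ e]; exists a.
by case=> a e; exists (a, q).
Qed.

Lemma mem_ground_intro A (f : A -> name P) a p : p ||- f a \In ground_name f.
Proof.
by apply/mem_ground; apply: dense_ret => q _; exists a; apply: eq_refl_forced.
Qed.

(** * Natural numbers *)

Lemma mem_succ x y p :
  p ||- x \In succ_name y <-> D p (fun q => q ||- x \In y \/ q ||- x = y).
Proof.
case: y => A f c; split=> H; apply: dense_bind H _ => q qp.
  case=> [[a|s] qa e]; apply: dense_ret => r rq; last first.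
    by right; apply: forces_eq_le e.
  left; apply: dense_ret => s sr; exists a; last first.
    by apply: forces_eq_le e; apply: le_trans sr rq.
  by apply: le_trans sr (le_trans rq qa).
case=> [H|e]; first by apply: dense_map H _ => r rq [a ra e]; exists (inl a).
apply: dense_ret => r rq; exists (inr r); first exact: le_refl.
exact: forces_eq_le e.
Qed.

Lemma mem_nat x n p :
  p ||- x \In nat_name n <->
  D p (fun q => exists2 m, m < n & q ||- x = nat_name m).
Proof.
elim: n p => [|n IH] p.
  by rewrite mem_ground; split=> /dense_ex[q _ []].
rewrite mem_succ; split=> H; apply: dense_bind H _ => q qp.
  case=> [/IH H|e]; first by apply: dense_map H _ => r _ [m mn e];
    exists m => //; apply: leqW.
  by apply: dense_ret => r rq; exists n => //; apply: forces_eq_le e.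
case=> m; rewrite ltnS leq_eqVlt => /orP[/eqP ->|mn] e;
  apply: dense_ret => r rq.
  by right; apply: forces_eq_le e.
left; apply/IH; apply: dense_ret => s sr; exists m => //.
by apply: forces_eq_le e; apply: le_trans sr rq.
Qed.

Lemma mem_nat_intro m n p : m < n -> p ||- nat_name m \In nat_name n.
Proof.
move=> mn; apply/mem_nat; apply: dense_ret => q _; exists m => //.
exact: eq_refl_forced.
Qed.

(** Descent: if [n] is forced into itself, it is equal below some condition to an [m < n], and then
    [m], being in [n], is in itself. *)
Lemma nat_irrefl n p : ~ p ||- nat_name n \In nat_name n.
Proof.
elim/ltn_ind: n p => n IH p /mem_nat/dense_ex[q _ [m mn e]].
apply: (IH m mn q); apply: (mem_eqr e).
exact: mem_nat_intro.
Qed.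

Lemma nat_name_inj m n p : p ||- nat_name m = nat_name n -> m = n.
Proof.
move=> e; have [mn|nm|//] := ltngtP m n; exfalso.
  by apply: (@nat_irrefl m p);
    apply: mem_eqr (eq_sym_forced e) (mem_nat_intro _ mn).
by apply: (@nat_irrefl n p); apply: mem_eqr e (mem_nat_intro _ nm).
Qed.

Lemma mem_omega x p :
  p ||- x \In omega_name <-> D p (fun q => exists n, q ||- x = nat_name n).
Proof. exact: mem_ground. Qed.

Lemma mem_omega_intro n p : p ||- nat_name n \In omega_name.
Proof. exact: mem_ground_intro. Qed.

(** * Ground model sets of natural numbers *)

Lemma mem_set x (A : set nat) p :
  p ||- x \In set_name A <->
  D p (fun q => exists2 n, A n & q ||- x = nat_name n).
Proof.
rewrite mem_ground; split=> H; apply: dense_map H _ => q _.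
  by case=> [[n An] e]; exists n.
by case=> n An e; exists (exist _ n An).
Qed.

Lemma mem_set_nat n (A : set nat) p : p ||- nat_name n \In set_name A <-> A n.
Proof.
rewrite mem_set; split=> [/dense_ex[q _ [m Am /nat_name_inj ->]] //|An].
by apply: dense_ret => q _; exists n => //; apply: eq_refl_forced.
Qed.

Lemma set_name_inj (A B : set nat) p : p ||- set_name A = set_name B -> A = B.
Proof.
move=> e; apply/seteqP; split=> n Xn; apply/(mem_set_nat n _ p).
  by apply: mem_eqr e _; apply/mem_set_nat.
by apply: mem_eqr (eq_sym_forced e) _; apply/mem_set_nat.
Qed.

Lemma mem_family x (I : set (set nat)) p :
  p ||- x \In family_name I <->
  D p (fun q => exists2 A, I A & q ||- x = set_name A).
Proof.
rewrite mem_ground; split=> H; apply: dense_map H _ => q _.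
  by case=> [[A IA] e]; exists A.
by case=> A IA e; exists (exist _ A IA).
Qed.

Lemma mem_family_intro (I : set (set nat)) A p :
  I A -> p ||- set_name A \In family_name I.
Proof.
move=> IA; apply/mem_family; apply: dense_ret => q _.
by exists A => //; apply: eq_refl_forced.
Qed.

(** * Pairs *)

Definition upair_name x y : name P :=
  ground_name (fun b : bool => if b then x else y).

Definition opair_name x y : name P :=
  upair_name (upair_name x x) (upair_name x y).

Lemma mem_upair w x y p :
  p ||- w \In upair_name x y <-> D p (fun q => q ||- w = x \/ q ||- w = y).
Proof.
rewrite mem_ground; split=> H; apply: dense_map H _ => q _.
  by case=> [[] e]; [left|right].
by case=> e; [exists true|exists false].
Qed.

Lemma mem_upairl x y p : p ||- x \In upair_name x y.
Proof. exact: (mem_ground_intro _ true). Qed.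

Lemma mem_upairr x y p : p ||- y \In upair_name x y.
Proof. exact: (mem_ground_intro _ false). Qed.

Lemma mem_upair1 w x p : p ||- w \In upair_name x x -> p ||- w = x.
Proof. by move/mem_upair/forces_bind; apply=> q _ []. Qed.

Lemma upair_name_eq x y x' y' p : p ||- x = x' -> p ||- y = y' ->
  p ||- upair_name x y = upair_name x' y'.
Proof.
have sub u v u' v' q z : q ||- u = u' -> q ||- v = v' ->
    q ||- z \In upair_name u v -> q ||- z \In upair_name u' v'.
  move=> eu ev /mem_upair H; apply/mem_upair; apply: dense_map H _ => r rq.
  by case=> e; [left|right]; apply: eq_trans_forced e _;
    apply: forces_eq_le rq _.
move=> ex ey; apply: eq_ext_forced => z q qp; apply: sub;
  try exact: forces_eq_le qp _;
  by apply: eq_sym_forced; apply: forces_eq_le qp _.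
Qed.

Lemma opair_name_eq x y x' y' p : p ||- x = x' -> p ||- y = y' ->
  p ||- opair_name x y = opair_name x' y'.
Proof. by move=> ex ey; do !apply: upair_name_eq. Qed.

Lemma IsUpair_name x y p : p ||- IsUpair (upair_name x y) x y.
Proof. by move=> w; split=> q qp /mem_upair. Qed.

Lemma IsUpair_eq z x y p : p ||- IsUpair z x y -> p ||- z = upair_name x y.
Proof.
move=> H; apply: eq_ext_forced => w q qp; have [H1 H2] := H w.
  by move=> /(H1 q qp) K; apply/mem_upair.
by move=> /mem_upair /(H2 q qp).
Qed.

Lemma IsOpair_eq z x y p : p ||- IsOpair z x y -> p ||- z = opair_name x y.
Proof.
move=> H; apply: (forces_bind H) => {H} q _ [u H].
apply: (forces_bind H) =>
  {H} r _ [v [/IsUpair_eq hu [/IsUpair_eq hv /IsUpair_eq hz]]].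
by apply: eq_trans_forced hz _; apply: upair_name_eq.
Qed.

Lemma IsOpair_name x y p : p ||- IsOpair (opair_name x y) x y.
Proof.
apply: (@forces_ex _ (upair_name x x)); apply: (@forces_ex _ (upair_name x y)).
by split; [|split]; apply: IsUpair_name.
Qed.

Lemma IsOpair_intro z x y p : p ||- z = opair_name x y -> p ||- IsOpair z x y.
Proof.
by move=> e; apply: (respects_IsOpair (eq_sym_forced e)); apply: IsOpair_name.
Qed.

(** The formula is traded for membership of a canonical Kuratowski pair, which can be handled by
    substitution. *)
Lemma OpairInE x y h p :
  p ||- OpairIn x y h <-> p ||- opair_name x y \In h.
Proof.
split=> [H|H].
  apply: (forces_bind H) => q _ [z [zh /IsOpair_eq e]].
  exact: mem_eql e zh.
by apply: (@forces_ex _ (opair_name x y)); split => //; apply: IsOpair_name.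
Qed.

Lemma opair_name_inj x y x' y' p : p ||- opair_name x y = opair_name x' y' ->
  p ||- x = x' /\ p ||- y = y'.
Proof.
move=> e; have ex : p ||- x = x'.
  have : p ||- upair_name x x \In opair_name x' y'.
    by apply: mem_eqr e _; apply: mem_upairl.
  move/mem_upair/forces_bind; apply=> q _ [] h; apply: eq_sym_forced;
    by apply: mem_upair1; apply: mem_eqr (eq_sym_forced h) _; apply: mem_upairl.
split=> //.
have : p ||- upair_name x y \In opair_name x' y'.
  by apply: mem_eqr e _; apply: mem_upairr.
move/mem_upair/forces_bind; apply=> q qp [] h.
(* Here the pair of [x] and [y] equals the singleton of [x'], so all four names collapse to one. *)
- have yx' : q ||- y = x'.
    by apply: mem_upair1; apply: mem_eqr h _; apply: mem_upairr.
  have xx' := forces_eq_le qp ex.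
  have : q ||- upair_name x' y' \In opair_name x y.
    apply: mem_eqr (eq_sym_forced (forces_eq_le qp e)) _; exact: mem_upairr.
  move/mem_upair/forces_bind; apply=> r rq [] k.
    have y'x : r ||- y' = x.
      by apply: mem_upair1; apply: mem_eqr k _; apply: mem_upairr.
    apply: eq_trans_forced (forces_eq_le rq yx') _; apply: eq_sym_forced.
    exact: eq_trans_forced y'x (forces_eq_le rq xx').
  apply: eq_sym_forced;
    apply: eq_trans_forced (eq_sym_forced (forces_eq_le rq yx')).
  apply: mem_upair1; apply: mem_eqr (forces_eq_le rq h) _.
  by apply: mem_eqr k _; apply: mem_upairr.
(* Here the unordered pairs agree; only the case where [y] equals [x'] remains, and then [y'] is [x]
   or [y]. *)
- have : q ||- y \In upair_name x' y' by apply: mem_eqr h _; apply: mem_upairr.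
  move/mem_upair/forces_bind; apply=> r rq [] // yx'.
  have xx' := forces_eq_le (le_trans rq qp) ex.
  have : r ||- y' \In upair_name x y.
    by apply: mem_eqr (eq_sym_forced (forces_eq_le rq h)) _; apply: mem_upairr.
  move/mem_upair/forces_bind; apply=> s sr [] k; apply: eq_sym_forced => //.
  apply: eq_trans_forced k _; apply: eq_trans_forced (forces_eq_le sr xx') _.
  by apply: eq_sym_forced; apply: forces_eq_le yx'.
Qed.

(** * Finite sets *)

(** The condition is shrunk once for each index, and the persistence of [Q] keeps the witnesses
    found before. *)
Lemma dense_finite_choice (Y : Type) (y0 : Y) (Q : nat -> Y -> P -> Prop) n p :
  (forall i c q r, le r q -> Q i c q -> Q i c r) ->
  (forall i, i < n -> D p (fun q => exists c, Q i c q)) ->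
  exists2 q, le q p & exists y : nat -> Y, forall i, i < n -> Q i (y i) q.
Proof.
move=> Qle; elim: n => [|n IH] H; first by exists p => //; exists (fun=> y0).
have [|q qp [y yP]] := IH; first by move=> i /leqW; apply: H.
have [r rq [z zP]] := H n (ltnSn n) q qp.
exists r; first exact: le_trans rq qp.
exists (fun i => if i == n then z else y i) => i; rewrite ltnS leq_eqVlt.
have [-> //|_ /= /yP] := eqVneq i n; exact: Qle.
Qed.

(** First the length of the enumeration is decided to be an actual [n]; then a name for each of the
    [n] values of the bijection is chosen below a single condition. *)
Lemma forces_Fin_elim x p : p ||- Fin x ->
  exists2 q, le q p & exists n (y : nat -> name P),
    (forall i, i < n -> q ||- y i \In x) /\
    (forall z r, le r q -> r ||- z \In x ->
       D r (fun s => exists2 i, i < n & s ||- z = y i)).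
Proof.
move=> /dense_ex[q1 q1p [N [Nw /dense_ex[q2 q21 [h [_ [tot onto]]]]]]].
have /mem_omega/dense_ex[q3 q32 [n eN]] := forces_mem_le q21 Nw.
(* The uniqueness clause is kept, to identify later any element paired with [i] with the chosen
   name. *)
pose Q i y q := q ||- y \In x /\ (q ||- OpairIn (nat_name i) y h /\
  forall z r, le r q -> r ||- z \In x -> r ||- OpairIn (nat_name i) z h ->
    r ||- z = y).
have [||q qq3 [y yP]] := @dense_finite_choice _ (@omega_name P) Q n q3.
- move=> i y q r rq [yx [yh yu]].
  split; [exact: forces_le yx|split; first exact: forces_le yh].
  by move=> z s sr; apply: yu; apply: le_trans sr rq.
- move=> i ni; have iN : q3 ||- nat_name i \In N.
    by apply: mem_eqr (eq_sym_forced eN) _; apply: mem_nat_intro.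
  apply: dense_map (tot (nat_name i) q3 q32 iN) _ => r _ [y [yx [yh yu]]].
  exists y; split => //; split => // z s sr zx zh.
  by apply: (yu z s sr zx s (le_refl s)).
exists q; first by apply: le_trans qq3 (le_trans q32 (le_trans q21 q1p)).
exists n, y; split => [i /yP[]//|z r rq zx].
have rq3 := le_trans rq qq3.
apply: dense_bind (onto z r (le_trans rq3 q32) zx) _ => s sr [a [aN [azh _]]].
have : s ||- a \In nat_name n.
  by apply: mem_eqr (forces_eq_le (le_trans sr rq3) eN) aN.
move=> /mem_nat H; apply: dense_map H _ => t ts [i ni ai]; exists i => //.
have [_ [_ yu]] := yP i ni; apply: yu.
- exact: le_trans ts (le_trans sr rq).
- by refine (forces_mem_le _ zx); apply: le_trans ts sr.
- apply/OpairInE; apply: mem_eql (opair_name_eq ai (eq_refl_forced z t)) _.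
  by apply/OpairInE; exact: (@forces_le (OpairIn a z h) s t ts azh).
Qed.

Lemma forces_Fin_bounded x p :
  (forall z q, le q p -> q ||- z \In x -> q ||- z \In omega_name) ->
  p ||- Fin x -> exists2 q, le q p & exists N, forall n r,
    le r q -> r ||- nat_name n \In x -> n < N.
Proof.
move=> xw /forces_Fin_elim[q qp [n [y [yx xy]]]].
have [||r rq [k kP]] := @dense_finite_choice _ 0
    (fun i k r => r ||- y i = nat_name k) n q.
- by move=> i k s r rs; apply: forces_eq_le.
- by move=> i ni; apply/mem_omega; apply: xw => //; apply: yx.
exists r; first exact: le_trans rq qp.
exists (\max_(i < n) k i).+1 => m s sr mx; rewrite ltnS.
have [t ts [i ni e]] := dense_ex (xy _ s (le_trans sr rq) mx).
have /nat_name_inj -> : t ||- nat_name m = nat_name (k i).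
  by apply: eq_trans_forced e _; apply: forces_eq_le (le_trans ts sr) (kP i ni).
exact: (@leq_bigmax _ (fun i : 'I_n => k i) (Ordinal ni)).
Qed.

(** A bijection is named outright, by the canonical pairs of [i] and [y i]. *)
Lemma forces_Fin_intro n (y : nat -> name P) x p :
  (forall i j q, i < n -> j < n -> q ||- y i = y j -> i = j) ->
  (forall i, i < n -> p ||- y i \In x) ->
  (forall z q, le q p -> q ||- z \In x ->
     D q (fun r => exists2 i, i < n & r ||- z = y i)) ->
  p ||- Fin x.
Proof.
move=> y_inj yx xy.
pose h := ground_name (fun i : 'I_n => opair_name (nat_name i) (y i)).
have memh a b q : q ||- OpairIn a b h -> D q (fun r =>
    exists2 i, i < n & r ||- a = nat_name i /\ r ||- b = y i).
  move=> /OpairInE/mem_ground H;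
    apply: dense_map H _ => r _ [i /opair_name_inj e].
  by exists i.
have hmem i q : i < n -> q ||- OpairIn (nat_name i) (y i) h.
  by move=> ni; apply/OpairInE; apply: (mem_ground_intro _ (Ordinal ni)).
apply: (@forces_ex _ (nat_name n)); apply: forces_and;
  first exact: mem_omega_intro.
apply: (@forces_ex _ h); apply: forces_and; last apply: forces_and.
- apply: forces_all_in => z q qp /mem_ground/forces_bind;
    apply=> r rq [[i ni] e].
  apply: (@forces_ex _ (nat_name i)); apply: forces_and;
    first exact: mem_nat_intro.
  apply: (@forces_ex _ (y i)); apply: forces_and.
    by apply: forces_le (yx i ni); apply: le_trans rq qp.
  exact: IsOpair_intro e.
- apply: forces_all_in => a q qp /mem_nat/forces_bind; apply=> r rq [i ni e].
  apply: (@forces_ex _ (y i)); apply: forces_and.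
    by apply: forces_le (yx i ni); apply: le_trans rq qp.
  apply: forces_and.
    apply/OpairInE; apply: mem_eql (opair_name_eq (eq_sym_forced e)
      (eq_refl_forced _ _)) _.
    by apply/OpairInE; apply: hmem.
  apply: forces_all_in => b s sr _; apply: forces_imp => t ts /memh/forces_bind.
  apply=> u ut [j nj [ej bj]].
  suff ij : i = j by rewrite ij.
  apply: (@nat_name_inj i j u); apply: eq_trans_forced ej.
  apply: eq_sym_forced; apply: forces_eq_le e.
  by apply: le_trans ut (le_trans ts sr).
- apply: forces_all_in => b q qp /xy H.
  apply: (forces_bind (H qp)) => r rq [i ni e].
  apply: (@forces_ex _ (nat_name i)); apply: forces_and;
    first exact: mem_nat_intro.
  apply: forces_and.
    apply/OpairInE; apply: mem_eql (opair_name_eq (eq_refl_forced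
      _ _) (eq_sym_forced e)) _.
    by apply/OpairInE; apply: hmem.
  apply: forces_all_in => a s sr _; apply: forces_imp => t ts /memh/forces_bind.
  apply=> u ut [j nj [aj ej]].
  suff ij : i = j by rewrite ij.
  apply: (y_inj i j u) => //; apply: eq_trans_forced ej.
  apply: eq_sym_forced; apply: forces_eq_le e.
  by apply: le_trans ut (le_trans ts sr).
Qed.

Lemma forces_Fin_ground (A : eqType) (S : set A) (f : A -> name P) x p :
  finite_set S ->
  (forall a b q, q ||- f a = f b -> a = b) ->
  (forall z q, le q p ->
     (q ||- z \In x <-> D q (fun r => exists2 a, S a & r ||- z = f a))) ->
  p ||- Fin x.
Proof.
move=> /finite_seqP[s0 Ss] f_inj xP.
have [s us Sus] : exists2 s : seq A, uniq s & forall a, S a <-> a \in s.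
  by exists (undup s0) => [|a]; rewrite ?undup_uniq // mem_undup Ss.
(* The empty set is treated apart, since [nth] needs a default element. *)
case: s us Sus => [|a0 s'] us Sus.
  apply: (@forces_Fin_intro 0 (fun=> omega_name)) => // z q qp /(xP z q qp) H.
  by apply: dense_map H _ => r _ [a /Sus].
set s := a0 :: s' in us Sus.
apply: (@forces_Fin_intro (size s) (fun i => f (nth a0 s i))).
- by move=> i j q ni nj /f_inj /eqP; rewrite nth_uniq // => /eqP.
- move=> i ni; apply/(xP _ _ (le_refl p)); apply: dense_ret => q _.
  exists (nth a0 s i); last exact: eq_refl_forced.
  by apply/Sus; rewrite mem_nth.
- move=> z q qp /(xP z q qp) H; apply: dense_map H _ => r _ [a /Sus as_ e].
  by exists (index a s); rewrite ?index_mem // nth_index.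
Qed.

(** * Finite partial functions *)

Definition ff_pair (a : set nat * bool) : name P :=
  opair_name (set_name a.1) (nat_name a.2).

Lemma ff_pair_inj a b p : p ||- ff_pair a = ff_pair b -> a = b.
Proof.
case: a b => [A b] [B c] /opair_name_inj[/set_name_inj /= -> /nat_name_inj].
by case: b c => [] [].
Qed.

(** This amounts to [p] forcing [g] to be the ground model function [g0], unfolded to a description
    of the elements of [g]. *)
Definition decodes (g : name P) (g0 : set (set nat * bool)) p :=
  forall z q, le q p ->
    (q ||- z \In g <-> D q (fun r => exists2 a, g0 a & r ||- z = ff_pair a)).

Lemma decodes_le g g0 p q : le q p -> decodes g g0 p -> decodes g g0 q.
Proof. by move=> qp H z r rq; apply: H; apply: le_trans rq qp. Qed.

Lemma decodes_mem g g0 p A b :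
  decodes g g0 p -> g0 (A, b) -> p ||- OpairIn (set_name A) (nat_name b) g.
Proof.
move=> gP gA; apply/OpairInE/(gP _ _ (le_refl p)); apply: dense_ret => q _.
by exists (A, b) => //; apply: eq_refl_forced.
Qed.

Lemma decodes_elim g g0 p x y : decodes g g0 p -> p ||- OpairIn x y g ->
  D p (fun q => exists A b,
    [/\ g0 (A, b), q ||- x = set_name A & q ||- y = nat_name (b : bool)]).
Proof.
move=> gP /OpairInE/(gP _ _ (le_refl p)) H; apply: dense_map H _ => q _.
by case=> -[A b] gA /opair_name_inj[ex ey]; exists A, b.
Qed.

Definition ff_name (g0 : set (set nat * bool)) : name P :=
  ground_name (fun a : {a | g0 a} => ff_pair (sval a)).

Lemma decodes_ff_name g0 p : decodes (ff_name g0) g0 p.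
Proof.
move=> z q qp; rewrite mem_ground; split=> H; apply: dense_map H _ => r _.
  by case=> [[a ga] e]; exists a.
by case=> a ga e; exists (exist _ a ga).
Qed.

(** Finite partial functions on a ground model family belong to the ground model: each of the
    finitely many entries is decided to be an actual pair, below one condition. *)
Lemma forces_InFF_elim (I : set (set nat)) g p : p ||- InFF (family_name I) g ->
  exists2 q, le q p & exists2 g0, FF I g0 & decodes g g0 q.
Proof.
move=> [/forces_Fin_elim[q1 q1p [n [y [yg gy]]]] [rel fct]].
have [||q qq1 [a aP]] := @dense_finite_choice (set nat * bool) (set0, true)
    (fun i a q => I a.1 /\ q ||- y i = ff_pair a) n q1.
- by move=> i a q r rq [Ia e]; split => //; apply: forces_eq_le e.
- move=> i ni; have H := rel (y i) q1 q1p (yg i ni).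
  apply: dense_bind H _ => r rq1 [x [/mem_family Hx H]].
  apply: dense_bind H _ => s sr [b [/mem_nat Hb /IsOpair_eq e]].
  apply: dense_bind (dense_le sr Hx) _ => t ts [A IA ex].
  apply: dense_map (dense_le ts Hb) _ => u ut [m m2 eb].
  (* As [m < 2], it is the number coded by the boolean [m == 1]. *)
  exists (A, m == 1); split => //.
  apply: eq_trans_forced (forces_eq_le (le_trans ut ts) e) _.
  apply: opair_name_eq; first exact: forces_eq_le ut ex.
  by case: m m2 eb => [|[|]].
exists q; first exact: le_trans qq1 q1p.
have dec : decodes g [set a i | i in `I_n] q.
  move=> z r rq; split=> H.
    have rq1 := le_trans rq qq1;
      apply: dense_map (gy z r rq1 H) _ => s sr [i ni e].
    exists (a i); first by exists i.
    apply: eq_trans_forced e _; apply: forces_eq_le (le_trans sr rq) _.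
    by have [] := aP i ni.
  apply: (forces_bind H) => s sr [_ [i ni <-] e].
  have [_ e'] := aP i ni.
  apply: mem_eql (eq_sym_forced e) _;
    apply: mem_eql (forces_eq_le (le_trans sr rq) e') _.
  by refine (forces_mem_le _ (yg i ni)); apply: le_trans sr (le_trans rq qq1).
exists [set a i | i in `I_n] => //; split.
- by apply: finite_image; apply: finite_II.
- by move=> A b [i ni e]; have [] := aP i ni; rewrite e.
- move=> A b c gb gc.
  have := fct (set_name A) (nat_name b) (nat_name c) q (le_trans qq1 q1p).
  move=> /(_ (decodes_mem dec gb) q (le_refl q) (decodes_mem dec gc)).
  by move=> /nat_name_inj; case: b c {gb gc} => [] [].
Qed.

Lemma forces_InFF_ff_name (I : set (set nat)) g0 p :
  FF I g0 -> p ||- InFF (family_name I) (ff_name g0).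
Proof.
move=> [fin gI fct]; apply: forces_and; last apply: forces_and.
- apply: (@forces_Fin_ground (set nat * bool)%type g0 ff_pair) => //.
    exact: ff_pair_inj.
  exact: decodes_ff_name.
- apply: forces_all_in =>
    z q qp /(@decodes_ff_name g0 q _ _ (le_refl q))/forces_bind.
  apply=> r rq [[A b] gA e].
  apply: (@forces_ex _ (set_name A)); apply: forces_and.
    by apply: mem_family_intro; apply: gI gA.
  apply: (@forces_ex _ (nat_name b)); apply: forces_and.
    by apply: mem_nat_intro; case: b {gA e}.
  exact: IsOpair_intro e.
- apply: forces_all => x; apply: forces_all => y; apply: forces_all => z.
  apply: forces_imp => q0 q0p xy; apply: forces_imp => q qq0 xz.
  have Hy := dense_le qq0 (decodes_elim (@decodes_ff_name g0 q0) xy).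
  have Hz := decodes_elim (@decodes_ff_name g0 q) xz.
  apply: (forces_bind Hy) => r rq [A [b [gA xA yb]]].
  apply: (forces_bind (dense_le rq Hz)) => s sr [B [c [gB xB zc]]].
  have AB : A = B.
    apply: (@set_name_inj A B s); apply: eq_trans_forced xB.
    by apply: eq_sym_forced; apply: forces_eq_le sr xA.
  subst B; have bc := fct _ _ _ gA gB; subst c.
  by apply: eq_trans_forced (forces_eq_le sr yb) _; apply: eq_sym_forced.
Qed.

Lemma forces_InIg g g0 x p : decodes g g0 p ->
  (p ||- InIg g x <-> D p (fun q => exists2 n, Ig g0 n & q ||- x = nat_name n)).
Proof.
move=> gP; split.
  move=> [/mem_omega H [H1 H0]]; apply: dense_map H _ => q qp [n e].
  exists n => //; split=> A gA.
    apply/(mem_set_nat n A q); apply: mem_eql e _.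
    by apply: (H1 (set_name A)) => //; apply: decodes_mem (decodes_le qp gP) gA.
  move=> An; have xA : q ||- x \In set_name A.
    by apply: mem_eql (eq_sym_forced e) _; apply/mem_set_nat.
  have Ag := decodes_mem (decodes_le qp gP) gA.
  exact: (H0 (set_name A) q qp Ag q (le_refl q) xA).
move/forces_bind; apply=> q qp [n [n1 n0] e].
apply: respects_InIg (eq_sym_forced e) _.
apply: forces_and; first exact: mem_omega_intro.
apply: forces_and; apply: forces_all => x'; apply: forces_imp => r rq h.
  have dr := decodes_le (le_trans rq qp) gP.
  apply: (forces_bind (decodes_elim dr h)) =>
    s sr [A [b [gA xA /nat_name_inj b1]]].
  apply: mem_eqr (eq_sym_forced xA) _; apply/mem_set_nat; apply: n1.
  by case: b b1 gA.
have dr := decodes_le (le_trans rq qp) gP.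
move=> s sr nx'; have [t ts [A [b [gA xA /nat_name_inj b0]]]] :=
  dense_ex (decodes_elim (decodes_le sr dr) (forces_le sr h)).
have bF : b = false by case: b b0 {gA}.
subst b.
by apply: (n0 A gA); apply/(mem_set_nat n A t);
  apply: mem_eqr xA (forces_mem_le ts nx').
Qed.

(** * Dense maximality *)

Lemma forces_neg F p : (forall q, le q p -> ~ q ||- F) -> p ||- (~ F).
Proof. by []. Qed.

(** Since [p] decides [G] at every point of [Ig g0], the class is a ground model set, and its
    canonical name is the witness. *)
Lemma forces_FinClass_InIg (g0 : set (set nat * bool)) (G : name P ->
  formula P) p :
  respects G ->
  (forall n, Ig g0 n -> p ||- G (nat_name n) \/
                        forall q, le q p -> ~ q ||- G (nat_name n)) ->
  finite_set [set n | Ig g0 n /\ p ||- G (nat_name n)] ->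
  p ||- FinClass (fun k => InIg (ff_name g0) k /\ G k)%frc.
Proof.
set S := [set n | _] => rG dec finS.
apply: (@forces_ex _ (set_name S)); apply: forces_and; last first.
  apply: (@forces_Fin_ground nat S nat_name) => //; first exact: nat_name_inj.
  by move=> z q _; exact: mem_set.
have dg q := @decodes_ff_name g0 q.
apply: forces_all => k; apply: forces_and; apply: forces_imp => q qp.
  move=> /mem_set/forces_bind; apply=> r rq [n [gn pG] e].
  apply: forces_and.
    apply/(forces_InIg k (dg r)); apply: dense_ret => s sr.
    by exists n => //; apply: forces_eq_le e.
  by apply: (rG _ _ _ (eq_sym_forced e)); apply: forces_le pG;
    apply: le_trans rq qp.
move=> [/(forces_InIg k (dg q)) H Gk]; apply/mem_set.
apply: dense_map H _ => r rq [n gn e]; exists n => //; split => //.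
have rGn := rG _ _ _ e (forces_le rq Gk).
by have [//|/(_ r (le_trans rq qp))] := dec n gn.
Qed.

(** Independence persists because finite functions can be decoded and names for finite sets of
    numbers can be bounded below a smaller condition. Maximality is reduced to deciding X on all but
    finitely many points of some [Ig h]. *)
Lemma forces_DenselyMaximal (I : set (set nat)) p : independent I ->
  (forall X q g0, FF I g0 -> exists r h N, [/\ le r q, FF I h, g0 `<=` h &
    (forall n s, N <= n -> Ig h n -> le s r -> ~ s ||- nat_name n \In X) \/
    (forall n, N <= n -> Ig h n -> r ||- nat_name n \In X)]) ->
  p ||- DenselyMaximal (family_name I).
Proof.
move=> [infI infIg] maxI; apply: forces_and; first apply: forces_and.
- apply: forces_all_in => A q qp /mem_family/forces_bind; apply=> r rq [B IB e].
  have Aw z s : le s r -> s ||- z \In A -> s ||- z \In omega_name.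
    move=> sr zA; have : s ||- z \In set_name B.
      by apply: mem_eqr zA; apply: forces_eq_le e.
    move=> /mem_set/forces_bind; apply=> t ts [n _ en].
    by apply: mem_eql (eq_sym_forced en) _; apply: mem_omega_intro.
  apply: forces_and; first exact: forces_all_in.
  apply: forces_neg => s sr FinA.
  have Aw' z t : le t s -> t ||- z \In A -> t ||- z \In omega_name.
    by move=> ts; apply: Aw; apply: le_trans ts sr.
  have [t ts [N bd]] := forces_Fin_bounded Aw' FinA.
  have [n Bn Nn] := infinite_nat_unbounded (infI B IB) N.
  have : n < N.
    apply: (bd n t (le_refl t)).
    apply: mem_eqr (eq_sym_forced (forces_eq_le (le_trans ts sr) e)) _.
    by apply/mem_set_nat.
  by rewrite ltnNge Nn.
- apply: forces_all => g; apply: forces_imp => q qp ff.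
  apply: forces_neg => r rq fin.
  have [s sr [g0 Ig0 dg]] := forces_InFF_elim (forces_le rq ff).
  have [t ts [y [yE finy]]] := fin s sr.
  have dt := decodes_le ts dg.
  have yw z u : le u t -> u ||- z \In y -> u ||- z \In omega_name.
    by move=> ut zy; have [H _] := yE z; have [] := H u ut zy.
  have [u ut [N bd]] := forces_Fin_bounded yw finy.
  have [n gn Nn] := infinite_nat_unbounded (infIg g0 Ig0) N.
  have : n < N.
    apply: (bd n u (le_refl u)); have [_ H] := yE (nat_name n).
    apply: (H u ut); apply/(forces_InIg _ (decodes_le ut dt)).
    by apply: dense_ret => v _; exists n => //; apply: eq_refl_forced.
  by rewrite ltnNge Nn.
- apply: forces_all => X; apply: forces_imp => q qp _.
  apply: forces_all => g'; apply: forces_imp => r rq ff.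
  apply: forces_dense => s sr.
  have [t ts [g0 Ig0 dg]] := forces_InFF_elim (forces_le sr ff).
  have [u [h [N [ut Ih gh dec]]]] := maxI X t g0 Ig0.
  (* The finitely many [n < N] are decided by one further extension, so that [v] decides X on all of
     [Ig h]. *)
  have [||v vu [c cP]] := @dense_finite_choice bool true (fun n b w =>
      if b then w ||- nat_name n \In X
      else forall w', le w' w -> ~ w' ||- nat_name n \In X) N u.
  + move=> i [] w w' ww' H; first exact: forces_mem_le ww' H.
    by move=> w'' ww''; apply: H; apply: le_trans ww'' ww'.
  + move=> i _ w wu; have [[w' ww' H]|none] :=
      pselect (exists2 w', le w' w & w' ||- nat_name i \In X).
      by exists w' => //; exists true.
    exists w; first exact: le_refl.
    by exists false => w' ww' H; apply: none; exists w'.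
  have decX n : Ig h n -> v ||- nat_name n \In X \/
      forall w, le w v -> ~ w ||- nat_name n \In X.
    move=> hn; have [nN|Nn] := ltnP n N.
      by have := cP n nN; case: (c n); [left|right].
    case: dec => [no|yes]; [right=> w wv|left].
      by apply: (no n w Nn hn); apply: le_trans wv vu.
    exact: forces_mem_le vu (yes n Nn hn).
  have respX : respects (fun k => k \In X)%frc by solve_respects.
  exists v; first by apply: le_trans vu (le_trans ut ts).
  apply: (@forces_ex _ (ff_name h)); apply: forces_and.
    exact: forces_InFF_ff_name.
  apply: forces_and.
    apply: forces_all_in => z w wv /(dg z w _) H.
    apply/(@decodes_ff_name h w _ _ (le_refl w)).
    apply: dense_map (H _) _; first by apply: le_trans wv (le_trans vu ut).
    by move=> w' _ [a /gh ha e]; exists a.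
  case: dec => [no|yes]; [apply: forces_orl|apply: forces_orr].
  + apply: (@forces_FinClass_InIg h (fun k => k \In X)%frc) => //.
    apply/finite_nat_bounded; exists N => n [hn nX]; rewrite ltnNge.
    by apply/negP => Nn; apply: (no n v Nn hn).
  + apply: (@forces_FinClass_InIg h (fun k => ~ k \In X)%frc).
    * exact: respects_neg.
    * move=> n hn; case: (decX n hn) => [nX|nX]; [right|left] => //.
      move=> w' w'v nnX; apply: (nnX w' (le_refl w')).
      exact: forces_mem_le nX.
    * apply/finite_nat_bounded; exists N => n [hn nX]; rewrite ltnNge.
      apply/negP => Nn; apply: (nX v (le_refl v)).
      exact: forces_mem_le vu (yes n Nn hn).
Qed.

End ForcingTheorem.

Theorem theorem4p1 (ch : CH) (I : set (set nat)) (hI : selective I) :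
  forced ML_le (DenselyMaximal (family_name I)).
Proof.
move=> p; have [[indI _] _] := hI.
apply: (forces_DenselyMaximal ML_le_refl ML_le_trans) => // X q g0 Ig0.
(* The two remaining hypotheses are that forcing passes to smaller conditions and that what is
   forced densely is forced. *)
apply: (@decide_on_density_filter
  (fun n r => forces ML_le r (nat_name n \In X)%frc)) => //.
  by move=> n r s; apply: (forces_mem_le ML_le_trans).
by move=> n r; apply: (forces_dense ML_le_refl ML_le_trans).
Qed.
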